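(* Let $T>0$ be a fixed expiry and let $C(K)=e^{-rT}\mathbb E^*[(X_T-K)^+]$ be the call pricing function in the (uncorrelated) Hull-White model. Then, as $K\to\infty$, $$C(K)=4T\xi^2C_0e^{-rT}(\log K)^{\frac{c_2+1}2}(\log\log K)^{c_3-1}\exp\left\{-\frac1{2T\xi^2}\left(\log\left[\frac1{y_0}\sqrt{\frac{2\log K}T}\right]+\frac12\log\log\left[\frac1{y_0}\sqrt{\frac{2\log K}T}\right]\right)^2\right\}\left(1+O\left((\log\log K)^{-\frac12}\right)\right),$$ where $C_0,c_2,c_3$ are the constants in the asymptotic formula for the density of $X_T$ given in the context.
   Context: Hull-White model: $dX_t=rX_tdt+Y_tX_tdW_t^*$, $dY_t=\nu Y_tdt+\xi Y_tdZ_t^*$, where $W^*,Z^*$ are independent Brownian motions under $\mathbb P^*$, $X_0=x_0>0$, $Y_0=y_0>0$, $r\ge0$, $\nu\in\mathbb R$, $\xi>0$. Let $D_T$ be the density of $X_T$. The following is known (a previously established result that may be taken as given): there are constants $C_0>0$ and $c_2,c_3\in\mathbb R$, depending on $T$ and the model parameters, such that as $x\to\infty$ $$D_T(x)=C_0x^{-2}(\log x)^{\frac{c_2-1}2}(\log\log x)^{c_3}\exp\left\{-\frac1{2T\xi^2}\left(\log\left[\frac1{y_0}\sqrt{\frac{2\log x}T}\right]+\frac12\log\log\left[\frac1{y_0}\sqrt{\frac{2\log x}T}\right]\right)^2\right\}\left(1+O\left((\log\log x)^{-\frac12}\right)\right).$$ *)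

(* Defs.v *)
From HB Require Import structures.
From mathcomp Require Import all_boot all_order all_algebra.
From mathcomp Require Import all_classical all_reals all_analysis.
Set Implicit Arguments.
Unset Strict Implicit.
Unset Printing Implicit Defensive.
Import Order.TTheory GRing.Theory Num.Theory.
Import numFieldNormedType.Exports.
Local Open Scope classical_set_scope.
Local Open Scope ring_scope.

(* Stochastic processes are curried maps X : R -> Omega -> R, and only their
   values at times t >= 0 are ever constrained. *)

Section stochastic_calculus.
Context {R : realType} {d : measure_display} {Omega : measurableType d}.
Implicit Types (P : probability Omega R) (F : R -> set (set Omega)).
Implicit Types (X W Z H b sigma : R -> Omega -> R).

Definition is_filtration F : Prop :=
  [/\ forall t : R, 0 <= t -> sigma_algebra setT (F t),
      forall t : R, 0 <= t -> F t `<=` measurable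
    & forall s t : R, 0 <= s -> s <= t -> F s `<=` F t].

Definition sub_measurable (G : set (set Omega)) (f : Omega -> R) : Prop :=
  forall B : set R, measurable B -> G (f @^-1` B).

Definition adapted F X : Prop :=
  forall t : R, 0 <= t -> sub_measurable (F t) (X t).

Definition continuous_paths X : Prop :=
  forall w, {within `[0, +oo[, continuous (fun t => X t w)}.

Definition increment W (s t : R) (w : Omega) : R := W t w - W s w.

Definition is_brownian F P W : Prop :=
  [/\ adapted F W,
      continuous_paths W,
      {ae P, forall w, W 0 w = 0},
      forall s t : R, 0 <= s -> s < t -> forall B : set R, measurable B ->
        P (increment W s t @^-1` B) = normal_prob 0 (Num.sqrt (t - s)) B
    & forall s t : R, 0 <= s -> s < t -> forall (A : set Omega) (B : set R),
        F s A -> measurable B ->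
        P (A `&` increment W s t @^-1` B) = (P A * P (increment W s t @^-1` B))%E].

Definition sigma_process X : set (set Omega) :=
  <<s [set A | exists t (B : set R),
         [/\ 0 <= t, measurable B & A = X t @^-1` B] ] >>.

Definition independent_processes P X Z : Prop :=
  forall A B, sigma_process X A -> sigma_process Z B ->
    P (A `&` B) = (P A * P B)%E.

(* The process \sum_(i < n) xi_i 1_]t_i, t_{i+1}] with bounded
   F_{t_i}-measurable coefficients xi_i. *)
Record simple_process F := SimpleProcess {
  sp_size : nat;
  sp_time : nat -> R;
  sp_coef : nat -> Omega -> R;
  sp_time_ge0 : 0 <= sp_time 0%N;
  sp_time_nd : nondecreasing_seq sp_time;
  sp_coef_meas : forall i, sub_measurable (F (sp_time i)) (sp_coef i);
  sp_coef_bounded : exists M, forall i w, `|sp_coef i w| <= M }.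

Definition sp_val F (S : simple_process F) (s : R) (w : Omega) : R :=
  \sum_(i < sp_size S)
    sp_coef S i w * \1_(`]sp_time S i, sp_time S i.+1]) s.

Definition sp_integral F (S : simple_process F) W (t : R) (w : Omega) : R :=
  \sum_(i < sp_size S)
    sp_coef S i w * (W (Num.min (sp_time S i.+1) t) w
                     - W (Num.min (sp_time S i) t) w).

(* J is (a version of) the Ito integral of H against W over [0, t]: the limit
   in probability of the integrals of simple processes S_n for which
   \int_0^t (S_n - H)^2 ds tends to 0 in probability. *)
Definition is_ito_integral F P W H (t : R) (J : Omega -> R) : Prop :=
  measurable_fun setT J /\
  exists S : nat -> simple_process F,
    (forall eps : R, 0 < eps ->
       P [set w | eps%:E <=
            \int[lebesgue_measure]_(s in `[0%R, t])
               ((sp_val (S n) s w - H s w) ^+ 2)%:E]%E @[n --> \oo] --> 0%E) /\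
    (forall eps : R, 0 < eps ->
       P [set w | eps <= `|sp_integral (S n) W t w - J w|]
         @[n --> \oo] --> 0%E).

(* dX_t = b_t dt + sigma_t dW_t with X_0 = x0; since Ito integrals are only
   defined up to null sets, so is the identity at each time t. *)
Definition solves_sde F P W X (x0 : R) b sigma : Prop :=
  [/\ adapted F X,
      continuous_paths X,
      {ae P, forall w, X 0 w = x0}
    & forall t : R, 0 <= t ->
        is_ito_integral F P W sigma t
          (fun w => X t w - X 0 w
                    - \int[lebesgue_measure]_(s in `[0, t]) b s w)].

Definition hull_white (r nu xi x0 y0 : R) F P W Z X (Y : R -> Omega -> R)
    : Prop :=
  [/\ is_filtration F,
      is_brownian F P W /\ is_brownian F P Z,
      independent_processes P W Z,
      solves_sde F P W X x0 (fun t w => r * X t w) (fun t w => Y t w * X t w)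
    & solves_sde F P Z Y y0 (fun t w => nu * Y t w) (fun t w => xi * Y t w)].

Definition is_density P (V : Omega -> R) (D : R -> R) : Prop :=
  [/\ measurable_fun setT D,
      forall x, 0 <= D x
    & forall B : set R, measurable B ->
        P (V @^-1` B) = (\int[lebesgue_measure]_(x in B) (D x)%:E)%E].

(* Extended-real valued, so that finiteness of the price is not presupposed. *)
Definition call_price P X (r T K : R) : \bar R :=
  ((expR (- (r * T)))%:E * 'E_P[(fun w => Num.max (X T w - K) 0)%R])%E.

End stochastic_calculus.

(* The Landau notations look up the filter among canonical instances, and the
   library declares none for +oo. *)
Canonical pinfty_nbhs_filter_on {R : realType} : filter_on R :=
  FilterType (pinfty_nbhs R) _.

(* f(x) = g(x) (1 + O(h(x))) as x -> +oo; in particular f(x) is finite for all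
   large x. *)
Definition equiv_upto {R : realType} (f : R -> \bar R) (g h : R -> R) : Prop :=
  exists e : R -> R, e =O_+oo h /\
    \forall x \near +oo, f x = (g x * (1 + e x))%:E.

Definition log_sqrt_log {R : realType} (T y0 x : R) : R :=
  ln (y0^-1 * Num.sqrt (2 * ln x / T)).

Definition hw_exp {R : realType} (T xi y0 x : R) : R :=
  expR (- (1 / (2 * T * xi ^+ 2))
        * (log_sqrt_log T y0 x + 1 / 2 * ln (log_sqrt_log T y0 x)) ^+ 2).

(* Main.v *)
(* By the density, e^{rT} C(K) is the integral over [K, oo) of (x - K) D(x), and
   D(x) ~ x^{-2} h(x) with h slowly varying.  Put v = log log x.  The proposed
   price asymptotics is G(K) = A exp(phi(v)), where phi'(v) = - k v (1 + O(v^{-1/2}))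
   and k = 1 / (4 T xi^2); hence - G'(x) = x^{-1} h(x) (1 + O(v^{-1/2})) with
   h(x) = k (v / log x) G(x), and integrating - G' gives the upper bound, since
   (x - K) x^{-2} <= x^{-1}.  For the lower bound, the part K x^{-2} h(x) integrates
   to at most sup_{x >= K} h(x), which is negligible because v / log x is tiny. *)
Require Import Defs.
From HB Require Import structures.
From mathcomp Require Import all_boot all_order all_algebra.
From mathcomp Require Import all_classical all_reals all_analysis.
From mathcomp Require Import measurable_realfun ring lra.
Import Order.TTheory GRing.Theory Num.Theory.
Import numFieldNormedType.Exports.
Local Open Scope classical_set_scope.
Local Open Scope ring_scope.

(** * The call price as an integral against the density *)

(** The hypothesis on [D] speaks of probabilities of sets only. It makes the law of [V] absolutely
    continuous with respect to Lebesgue measure, and the Radon-Nikodym derivative has the same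
    integral as [D] over every measurable set, so the two agree almost everywhere and the change of
    variables holds with [D]. *)
Lemma integral_is_density d (Omega : measurableType d) (R : realType)
    (P : probability Omega R) (V : Omega -> R) (D : R -> R) (f : R -> R) :
  measurable_fun setT V -> is_density P V D ->
  measurable_fun setT f -> (forall x, 0 <= f x) ->
  (\int[P]_w (f (V w))%:E = \int[lebesgue_measure]_x (f x * D x)%:E)%E.
Proof.
move=> mV [mD D0 PD] mf f0.
have mV' : measurable_fun setT (V : Omega -> measurableTypeR R) by exact: mV.
pose V' : {RV P >-> measurableTypeR R} :=
  HB.pack (V : Omega -> measurableTypeR R)
    (isMeasurableFun.Build _ _ _ (measurableTypeR R) _ mV').
have mDE := (measurable_EFinP _ _).2 mD.
have dom : distribution P V' `<< (@lebesgue_measure R).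
  apply/null_content_dominatesP => A mA A0.
  rewrite /distribution /pushforward PD//.
  by apply: null_set_integral => //; exact: measurable_funTS.
have mfE := (measurable_EFinP _ _).2 mf.
have fE0 x : (0 <= (EFin \o f) x)%E by rewrite lee_fin.
rewrite -[LHS](ge0_integral_distribution V' mfE)//.
under [RHS]eq_integral do rewrite EFinM.
rewrite -(Radon_Nikodym_SigmaFinite.change_of_variables
  (nu := distribution P V') (mu := lebesgue_measure) dom)//.
have iRN := Radon_Nikodym_SigmaFinite.f_integrable
  (nu := distribution P V') (mu := lebesgue_measure) dom.
apply: ae_eq_integral => //.
- by apply: emeasurable_funM => //; exact: measurable_int iRN.
- exact: emeasurable_funM.
apply: ae_eqe_mul2l; apply: integral_ae_eq => //= E _ mE.
rewrite -Radon_Nikodym_SigmaFinite.f_integral//; exact: PD.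
Qed.

Lemma call_price_density d (Omega : measurableType d) (R : realType)
    (P : probability Omega R) (X : R -> Omega -> R) (r T K : R) (D : R -> R) :
  measurable_fun setT (X T) -> is_density P (X T) D ->
  call_price P X r T K = ((expR (- (r * T)))%:E *
    \int[lebesgue_measure]_(x in `[K, +oo[) ((x - K) * D x)%:E)%E.
Proof.
move=> mX hD; have [mD D0 _] := hD.
rewrite /call_price unlock; congr (_ * _)%E.
rewrite (integral_is_density _ _ _ _ _ _ (fun x => Num.max (x - K) 0) mX hD);
  last 2 first.
- by apply: measurable_maxr => //; exact: measurable_funB.
- by move=> x; rewrite le_max lexx orbT.
rewrite [RHS]integral_mkcond; apply: eq_integral => x _.
rewrite patchE mem_setE in_itv/= andbT.
case: (leP K x) => Kx; first by rewrite max_l// subr_ge0.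
by rewrite max_r ?mul0r// subr_le0 ltW.
Qed.

(** * Tail integrals, and two-sided bounds for the call integral *)

(** The fundamental theorem of calculus on a half-line, applied to the primitive [- F] of [f], which
    tends to 0 at infinity. *)
Lemma integral_to0_derive (R : realType) (F f : R -> R) (K : R) :
  (forall x, K <= x -> is_derive x 1 F (- f x)) ->
  (forall x, K <= x -> {for x, continuous f}) ->
  (forall x, K <= x -> 0 <= f x) -> F x @[x --> +oo] --> 0 ->
  (\int[lebesgue_measure]_(x in `[K, +oo[) (f x)%:E = (F K)%:E)%E.
Proof.
move=> dF cf f0 F0.
have dNF x : K <= x -> is_derive x 1 (- F) (f x).
  by move=> /dF dFx; rewrite -[f x]opprK; exact: is_deriveN.
rewrite (@ge0_continuous_FTC2y _ f (- F) K 0) //.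
- by rewrite EFinN oppeK add0e.
- apply: continuous_in_subspaceT => x; rewrite mem_setE in_itv/= andbT.
  exact: cf.
- by rewrite -oppr0; exact: cvgN.
- by move=> x /ltW /dNF dx; exact: ex_derive.
- apply: cvg_at_right_filter.
  have dK : derivable (- F) K 1 by have := dNF K (lexx _) => dK; exact: ex_derive.
  exact/differentiable_continuous/derivable1_diffP.
- move=> x; rewrite in_itv/= andbT => /ltW /dNF dx.
  by rewrite derive1E derive_val.
Qed.

Lemma integral_inv_sqr (R : realType) (K : R) : 0 < K ->
  (\int[lebesgue_measure]_(x in `[K, +oo[) (x ^- 2)%:E = (K^-1)%:E)%E.
Proof.
move=> K0.
apply: (integral_to0_derive R (fun x => x^-1) (fun x => x ^- 2)).
- move=> x Kx; have x0 : x != 0 by rewrite gt_eqF// (lt_le_trans K0).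
  have -> : - x ^- 2 = - x ^- 2 *: (1 : R) by rewrite /GRing.scale/= mulr1.
  exact: is_deriveV.
- move=> x Kx; have x0 : x != 0 by rewrite gt_eqF// (lt_le_trans K0).
  by apply: cvgV; [rewrite expf_neq0|exact: exprn_continuous].
- by move=> x Kx; rewrite invr_ge0 exprn_ge0// (le_trans (ltW K0)).
- apply/gtr0_cvgV0; last exact: cvg_id.
  by near=> x; near: x; apply: nbhs_pinfty_gt; exact: num_real.
Unshelve. all: by end_near. Qed.

(** Chains two pointwise comparisons: [D] with [x ^- 2 * h x] up to the relative error [a], and
    [x^-1 * h x] with [g], minus the derivative of [G], up to the relative error [b]. Since [g]
    integrates to [G K], the errors pass to the integral. The upper bound uses [x - K <= x]; in the
    lower one the strike costs at most [K * M] times the integral [K^-1] of [x ^- 2]. *)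
Lemma call_integral_bounds (R : realType) (D G g h : R -> R) (K a b M : R) :
  0 < K -> 0 <= a <= 1 -> 0 <= b <= 1 ->
  measurable_fun setT D -> (forall x, 0 <= D x) ->
  (forall x, K <= x -> is_derive x 1 G (- g x)) ->
  (forall x, K <= x -> {for x, continuous g}) ->
  (forall x, K <= x -> 0 <= g x) -> G x @[x --> +oo] --> 0 ->
  (forall x, K <= x ->
    (1 - a) * (x ^- 2 * h x) <= D x <= (1 + a) * (x ^- 2 * h x)) ->
  (forall x, K <= x -> (1 - b) * g x <= x^-1 * h x <= (1 + b) * g x) ->
  (forall x, K <= x -> h x <= M) ->
  exists I : R,
    (\int[lebesgue_measure]_(x in `[K, +oo[) ((x - K) * D x)%:E)%E = I%:E /\
    (1 - a) * (1 - b) * G K - M <= I <= (1 + a) * (1 + b) * G K.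
Proof.
move=> K0 /andP[a0 a1] /andP[b0 b1] mD D0 dG cg g0 G0 Dh hg hM.
have gt0 x : K <= x -> 0 < x by exact: lt_le_trans.
(* The sign of [h] follows from the lower comparison with [g], because [b <= 1]. *)
have h0 x : K <= x -> 0 <= h x.
  move=> Kx; have x0 := gt0 _ Kx; have /andP[+ _] := hg _ Kx.
  move=> /(le_trans (mulr_ge0 _ (g0 _ Kx))); rewrite subr_ge0 => /(_ b1).
  by rewrite pmulr_rge0// invr_gt0.
have M0 : 0 <= M by exact: le_trans (h0 K (lexx K)) (hM _ (lexx K)).
have upper x : K <= x -> (x - K) * D x <= (1 + a) * (1 + b) * g x.
  move=> Kx; have x0 := gt0 _ Kx.
  have /andP[_ Dx] := Dh _ Kx; have /andP[_ hx] := hg _ Kx.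
  apply: (@le_trans _ _ (x * ((1 + a) * (x ^- 2 * h x)))).
    rewrite (@le_trans _ _ (x * D x))//.
      by rewrite ler_wpM2r// gerBl ltW.
    by rewrite ler_wpM2l// ltW.
  have -> : x * ((1 + a) * (x ^- 2 * h x)) = (1 + a) * (x^-1 * h x).
    by field; rewrite gt_eqF.
  by rewrite -mulrA ler_wpM2l// addr_ge0.
(* [M], the bound on [h], pays for the part [- K * D x] of the payoff. *)
have lower x : K <= x ->
    (1 - a) * (1 - b) * g x <= (x - K) * D x + K * M * x ^- 2.
  move=> Kx; have x0 := gt0 _ Kx.
  have /andP[Dx _] := Dh _ Kx; have /andP[hx _] := hg _ Kx.
  have a1' : 0 <= 1 - a by rewrite subr_ge0.
  apply: (@le_trans _ _ ((1 - a) * (x^-1 * h x))).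
    by rewrite -mulrA ler_wpM2l.
  apply: (@le_trans _ _ ((x - K) * ((1 - a) * (x ^- 2 * h x)) + K * M * x ^- 2)); last first.
    by rewrite lerD2r ler_wpM2l// subr_ge0.
  rewrite -subr_ge0.
  have -> : (x - K) * ((1 - a) * (x ^- 2 * h x)) + K * M * x ^- 2 -
      (1 - a) * (x^-1 * h x) = K * x ^- 2 * ((M - h x) + a * h x).
    by field; rewrite gt_eqF.
  rewrite mulr_ge0// ?mulr_ge0 ?invr_ge0 ?exprn_ge0//; try exact: ltW.
  by rewrite addr_ge0 ?subr_ge0 ?hM// mulr_ge0// h0.
have mK : measurable (`[K, +oo[ : set R) by exact: measurable_itv.
have mg : measurable_fun (`[K, +oo[ : set R) g.
  apply: subspace_continuous_measurable_fun => //.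
  apply: continuous_in_subspaceT => x; rewrite mem_setE in_itv/= andbT.
  exact: cg.
have mCD : measurable_fun (`[K, +oo[ : set R) (fun x => (x - K) * D x).
  apply: measurable_funM; last exact: measurable_funTS.
  exact: measurable_funB.
have mV : measurable_fun (`[K, +oo[ : set R) (fun x : R => x ^- 2).
  apply: subspace_continuous_measurable_fun => //.
  apply: continuous_in_subspaceT => x; rewrite mem_setE in_itv/= andbT => Kx.
  apply: cvgV; last exact: exprn_continuous.
  by rewrite expf_neq0// gt_eqF// gt0.
have inK x : x \in `[K, +oo[ -> K <= x by rewrite in_itv/= andbT.
have Ig := integral_to0_derive _ _ _ _ dG cg g0 G0.
have CD0 x : K <= x -> 0 <= (x - K) * D x by move=> Kx; rewrite mulr_ge0// subr_ge0.
have ab0 : 0 <= (1 - a) * (1 - b) by rewrite mulr_ge0 ?subr_ge0.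
have AB0 : 0 <= (1 + a) * (1 + b) by rewrite mulr_ge0 ?addr_ge0.
have KM0 : 0 <= K * M by rewrite mulr_ge0// ltW.
set J := (\int[lebesgue_measure]_(x in _) _)%E.
have Jup : (J <= ((1 + a) * (1 + b) * G K)%:E)%E.
  rewrite EFinM -Ig -ge0_integralZl//; last 2 first.
  - exact/measurable_EFinP.
  - by move=> x /inK Kx; rewrite lee_fin g0.
  apply: ge0_le_integral => //.
  - by move=> x /inK Kx; rewrite lee_fin CD0.
  - exact/measurable_EFinP.
  - by apply/measurable_EFinP; exact: measurable_funM.
  - by move=> x /inK Kx; rewrite -EFinM lee_fin upper.
(* [M] is moved to the right and written as the integral of [K * M * x ^- 2], so that only
   nonnegative functions are integrated. *)
have Jlow : (((1 - a) * (1 - b) * G K)%:E <= J + M%:E)%E.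
  have -> : M%:E = (\int[lebesgue_measure]_(x in `[K, +oo[) (K * M * x ^- 2)%:E)%E.
    under eq_integral do rewrite EFinM.
    rewrite ge0_integralZl//; last 2 first.
    - exact/measurable_EFinP.
    - by move=> x /inK Kx; rewrite lee_fin invr_ge0 exprn_ge0// ltW// gt0.
    rewrite integral_inv_sqr// -EFinM; congr EFin.
    by field; rewrite gt_eqF.
  have Q0 x : K <= x -> 0 <= K * M * x ^- 2.
    by move=> Kx; rewrite mulr_ge0// invr_ge0 exprn_ge0// ltW// gt0.
  rewrite -ge0_integralD//; last 4 first.
  - by move=> x /inK Kx; rewrite lee_fin CD0.
  - exact/measurable_EFinP.
  - by move=> x /inK Kx; rewrite lee_fin Q0.
  - by apply/measurable_EFinP; exact: measurable_funM.
  rewrite EFinM -Ig -ge0_integralZl//; last 2 first.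
  - exact/measurable_EFinP.
  - by move=> x /inK Kx; rewrite lee_fin g0.
  apply: ge0_le_integral => //.
  - by move=> x /inK Kx; rewrite -EFinM lee_fin mulr_ge0// g0.
  - by apply/measurable_EFinP; exact: measurable_funM.
  - apply: emeasurable_funD; apply/measurable_EFinP => //.
    exact: measurable_funM.
  - by move=> x /inK Kx; rewrite -EFinM -EFinD lee_fin lower.
have J0 : (0 <= J)%E.
  by apply: integral_ge0 => x /inK Kx; rewrite lee_fin CD0.
(* Finiteness of the integral is a consequence of the upper bound. *)
have Jfin : J \is a fin_num.
  by rewrite ge0_fin_numE// (le_lt_trans Jup)// ltry.
exists (fine J); rewrite fineK//; split => //.
by rewrite lerBlDr -!lee_fin EFinD fineK// Jlow.
Qed.

(** * The exponent as a function of log log x: derivative and growth *)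

(* With v = log log x, the quantity c + v / 2 is log_sqrt_log, for
   c = log (y0^{-1} sqrt (2 / T)). *)
Definition exponent {R : realType} (k c p q v : R) : R :=
  p * v + q * ln v - 2 * k * (c + v / 2 + ln (c + v / 2) / 2) ^+ 2.

Definition dexponent {R : realType} (k c p q v : R) : R :=
  p + q / v - 4 * k * (c + v / 2 + ln (c + v / 2) / 2) *
                      (1 / 2 + (4 * (c + v / 2))^-1).

Lemma is_derive_exponent (R : realType) (k c p q v : R) :
  0 < v -> 0 < c + v / 2 ->
  is_derive v 1 (exponent k c p q) (dexponent k c p q v).
Proof.
move=> v0 l0.
have dl : is_derive v 1 (fun x : R => c + x / 2) (1 / 2).
  apply: is_derive_eq; rewrite /GRing.scale/=; lra.
have dln : is_derive v 1 (fun x : R => ln (c + x / 2)) ((c + v / 2)^-1 * (1 / 2)).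
  exact: (is_derive1_comp (f := @ln R) (g := fun x => c + x / 2) (x := v)
            (is_derive1_ln l0) dl).
have dlv : is_derive v 1 (@ln R) v^-1 by exact: is_derive1_ln.
rewrite /exponent.
apply: is_derive_eq.
rewrite /GRing.scale/= /dexponent.
by field; rewrite !gt_eqF//; lra.
Qed.

Lemma continuous_dexponent (R : realType) (k c p q v : R) :
  0 < v -> 0 < c + v / 2 -> {for v, continuous (dexponent k c p q)}.
Proof.
move=> v0 l0.
have cl : (fun x : R => c + x / 2) x @[x --> v] --> c + v / 2.
  by apply: cvgD; [exact: cvg_cst|apply: cvgM; [exact: cvg_id|exact: cvg_cst]].
have cln : (fun x : R => ln (c + x / 2)) x @[x --> v] --> ln (c + v / 2).
  by apply: continuous_cvg => //; exact: continuous_ln.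
rewrite /prop_for /continuous_at /dexponent.
apply: cvgB.
  apply: cvgD; first exact: cvg_cst.
  apply: cvgM; first exact: cvg_cst.
  by apply: cvgV => //; rewrite gt_eqF.
apply: cvgM.
  apply: cvgM; first exact: cvg_cst.
  by apply: cvgD => //; apply: cvgM => //; exact: cvg_cst.
apply: cvgD; first exact: cvg_cst.
apply: cvgV; first by rewrite mulf_neq0// gt_eqF.
by apply: cvgM => //; exact: cvg_cst.
Qed.

(** Write [ln x] as twice the logarithm of the square root and apply [ln y < y] there. *)
Lemma ln_le_sqrt (R : realType) (x : R) : 0 < x -> ln x <= 2 * Num.sqrt x.
Proof.
move=> x0; have s0 : 0 < Num.sqrt x by rewrite sqrtr_gt0.
rewrite -{1}(sqr_sqrtr (ltW x0)) lnXn// mulr2n mulrDl mul1r.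
by rewrite lerD// ltW// ln_sublinear.
Qed.

(** With [l = c + v / 2], expanding the product leaves [- k * v], bounded terms and [- k * ln l].
    The last is the only unbounded error, and [ln l <= 2 * Num.sqrt v]; relative to [k * v] this is
    the order [v^(-1/2)] of the final estimate. The threshold on [v] ensures [1 <= l <= v]. *)
Lemma dexponent_asymp (R : realType) (k c p q v : R) :
  0 <= k -> 2 + 2 * `|c| <= v ->
  `|dexponent k c p q v + k * v| <=
    (`|p| + `|q| + 2 * k * `|c| + 4 * k) * Num.sqrt v.
Proof.
move=> k0 hv.
have c0 : 0 <= `|c| by exact: normr_ge0.
have [cl cu] : - `|c| <= c /\ c <= `|c|.
  by apply/andP; rewrite -ler_norml.
set l := c + v / 2.
have l1 : 1 <= l by rewrite /l; lra.
have lv : l <= v by rewrite /l; lra.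
have v0 : 0 < v by lra.
have l0 : 0 < l by lra.
have L0 : 0 <= ln l by exact: ln_ge0.
have Ll : ln l / l <= 1.
  by rewrite ler_pdivrMr// mul1r ltW// ln_sublinear.
have Ll0 : 0 <= ln l / l by rewrite divr_ge0// ltW.
have Ls : ln l <= 2 * Num.sqrt v.
  by rewrite (le_trans (ln_le_sqrt _ _ l0))// ler_pM2l// ler_wsqrtr.
have s1 : 1 <= Num.sqrt v by rewrite -sqrtr1 ler_wsqrtr//; lra.
have -> : dexponent k c p q v + k * v =
    p + q / v - 2 * k * c - k * ln l - k - k * (ln l / l) / 2.
  (* Eliminating [v] in favour of [l] turns the claim into a rational identity in [l] and [ln l]. *)
  rewrite /dexponent -/l (_ : v = 2 * (l - c)); last by rewrite /l; field.
  by field; rewrite gt_eqF//= gt_eqF//; rewrite /l; lra.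
have qv : `|q / v| <= `|q|.
  rewrite normrM normfV (gtr0_norm v0) ler_pdivrMr//.
  by rewrite ler_peMr//; lra.
have := ler_norm p; have := ler_norm (- p); rewrite normrN => p1 p2.
have := ler_norm (q / v); have := ler_norm (- (q / v)); rewrite normrN => q1 q2.
set a := q / v in qv q1 q2 *; set s := Num.sqrt v in Ls s1 *.
set t := ln l / l in Ll Ll0 *.
have kc1 : k * c <= k * `|c| by rewrite ler_wpM2l.
have kc2 : - (k * `|c|) <= k * c by rewrite -mulrN ler_wpM2l.
have kL : k * ln l <= k * (2 * s) by rewrite ler_wpM2l.
have kL0 : 0 <= k * ln l by rewrite mulr_ge0.
have kt : k * t <= k by rewrite ler_piMr.
have kt0 : 0 <= k * t by rewrite mulr_ge0.
have p0 := normr_ge0 p; have q0 := normr_ge0 q.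
have ps : `|p| <= `|p| * s by rewrite ler_peMr.
have qs : `|q| <= `|q| * s by rewrite ler_peMr.
have cs : k * `|c| <= k * `|c| * s by rewrite ler_peMr// mulr_ge0.
have ks : k <= k * s by rewrite ler_peMr.
rewrite ler_norml; apply/andP; split; lra.
Qed.

(** The square dominates. The first threshold gives [v / 4 <= l], so the quadratic term is at most
    [- k * v ^+ 2 / 8]; the second makes this at most [- (|p| + |q| + 1) * v], which absorbs the
    terms in [p] and [q] and leaves [- v]. *)
Lemma exponent_le (R : realType) (k c p q v : R) :
  0 < k -> 4 + 4 * `|c| <= v -> 8 * (`|p| + `|q| + 1) / k <= v ->
  exponent k c p q v <= - v.
Proof.
move=> k0 hv hv2.
have c0 : 0 <= `|c| by exact: normr_ge0.
have [cl cu] : - `|c| <= c /\ c <= `|c|.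
  by apply/andP; rewrite -ler_norml.
rewrite /exponent; set l := c + v / 2.
have l1 : 1 <= l by rewrite /l; lra.
have lv : v / 4 <= l by rewrite /l; lra.
have v0 : 0 < v by lra.
have v1 : 1 <= v by lra.
have L0 : 0 <= ln l by exact: ln_ge0.
have sq : (v / 4) ^+ 2 <= (l + ln l / 2) ^+ 2.
  by rewrite ler_sqr ?nnegrE; lra.
have ksq : 2 * k * (v / 4) ^+ 2 <= 2 * k * (l + ln l / 2) ^+ 2.
  by rewrite ler_pM2l//; lra.
have pv : p * v <= `|p| * v by rewrite ler_wpM2r ?ler_norm//; lra.
have qv : q * ln v <= `|q| * v.
  apply: (@le_trans _ _ (`|q| * ln v)).
    by rewrite ler_wpM2r ?ler_norm// ln_ge0.
  by rewrite ler_wpM2l// ltW// ln_sublinear.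
have kv : 8 * (`|p| + `|q| + 1) * v <= k * v * v.
  by rewrite ler_pM2r// -ler_pdivrMl// mulrC.
rewrite expr2 in ksq; lra.
Qed.

(** * The candidate for the price and its rate of decay *)

(** The candidate for the undiscounted price: the powers of log x and log log x are absorbed into
    [exponent] as the terms in [p] and [q]. *)
Definition profile {R : realType} (k c p q A x : R) : R :=
  A * expR (exponent k c p q (ln (ln x))).

(** Minus the derivative of [profile], hence nonnegative for large [x]; [(x * ln x)^-1] is the
    derivative of log log x. *)
Definition profile_decay {R : realType} (k c p q A x : R) : R :=
  profile k c p q A x * - dexponent k c p q (ln (ln x)) / (x * ln x).

(** [ln] takes the value 0 on nonpositive arguments, so a positive [ln (ln x)] forces [ln x] to be
    positive. *)
Lemma lnln_gt0 (R : realType) (x : R) : 0 < x -> 0 < ln (ln x) -> 0 < ln x.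
Proof.
move=> x0; apply: contraTT; rewrite -!leNgt => lx.
by rewrite [ln (ln x)]ln0//.
Qed.

Lemma is_derive_profile (R : realType) (k c p q A x : R) :
  0 < x -> 0 < ln (ln x) -> 0 < c + ln (ln x) / 2 ->
  is_derive x 1 (profile k c p q A) (- profile_decay k c p q A x).
Proof.
move=> x0 v0 l0; have lx0 := lnln_gt0 _ _ x0 v0.
have dlnln := is_derive1_comp (f := @ln R) (g := @ln R) (x := x)
  (is_derive1_ln lx0) (is_derive1_ln x0).
have dexp := is_derive1_comp (f := exponent k c p q) (g := @ln R \o @ln R)
  (x := x) (is_derive_exponent _ k c p q _ v0 l0) dlnln.
have dE := is_derive1_comp (f := @expR R)
  (g := exponent k c p q \o (@ln R \o @ln R)) (x := x) (is_derive_expR _) dexp.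
have dG := is_deriveZ A dE.
apply: (is_derive_eq dG).
rewrite /profile_decay /profile /GRing.scale/=.
by field; rewrite !gt_eqF.
Qed.

Lemma continuous_profile_decay (R : realType) (k c p q A x : R) :
  0 < x -> 0 < ln (ln x) -> 0 < c + ln (ln x) / 2 ->
  {for x, continuous (profile_decay k c p q A)}.
Proof.
move=> x0 v0 l0; have lx0 := lnln_gt0 _ _ x0 v0.
have cG : {for x, continuous (profile k c p q A)}.
  have dG := is_derive_profile _ k c p q A _ x0 v0 l0.
  have dxG : derivable (profile k c p q A) x 1 by exact: ex_derive.
  exact/differentiable_continuous/derivable1_diffP.
have cln : {for x, continuous (@ln R)} by exact: continuous_ln.
have clnln : {for x, continuous (fun y => ln (ln y) : R)}.
  by apply: (@continuous_comp _ _ _ (@ln R) (@ln R)) => //; exact: continuous_ln.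
rewrite /prop_for /continuous_at /profile_decay.
apply: cvgM.
  apply: cvgM; first exact: cG.
  apply: cvgN.
  apply: (@continuous_comp _ _ _ (fun y => ln (ln y) : R) (dexponent k c p q)) => //.
  exact: continuous_dexponent.
apply: cvgV; first by rewrite mulf_neq0// gt_eqF.
by apply: cvgM => //; exact: cvg_id.
Qed.

Lemma near_lnln (R : realType) (V : R) :
  \forall x \near +oo, 1 < x /\ V <= ln (ln x).
Proof.
near=> x.
have x0 : expR (expR V) <= x.
  by near: x; apply: nbhs_pinfty_ge; exact: num_real.
have lx : expR V <= ln x.
  by rewrite -[leLHS]expRK ler_ln ?posrE ?expR_gt0// (lt_le_trans _ x0)// expR_gt0.
split.
  by rewrite (lt_le_trans _ x0)// expR_gt1 expR_gt0.
by rewrite -[leLHS]expRK ler_ln ?posrE ?expR_gt0// (lt_le_trans _ lx)// expR_gt0.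
Unshelve. all: by end_near. Qed.

Lemma cvg_profile (R : realType) (k c p q A : R) : 0 < k -> 0 <= A ->
  profile k c p q A x @[x --> +oo] --> 0.
Proof.
move=> k0 A0; apply/cvgrPdist_le => e e0.
near=> x.
have [] : 1 < x /\ 4 + 4 * `|c| <= ln (ln x) by near: x; exact: near_lnln.
have [_ + x1 v1] : 1 < x /\ 8 * (`|p| + `|q| + 1) / k <= ln (ln x).
  by near: x; exact: near_lnln.
move=> v2.
(* [exponent_le] bounds the profile by [A * expR (- v)] with [v = ln (ln x)], and [v <= expR v];
   hence this threshold for [e]. *)
have [_ v3] : 1 < x /\ A / e <= ln (ln x) by near: x; exact: near_lnln.
rewrite sub0r normrN /profile ger0_norm ?mulr_ge0 ?expR_ge0//.
apply: (@le_trans _ _ (A * expR (- ln (ln x)))).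
  by rewrite ler_wpM2l// ler_expR exponent_le.
rewrite expRN ler_pdivrMr ?expR_gt0// mulrC -ler_pdivrMr//.
by rewrite (le_trans v3)// (le_trans _ (expR_ge1Dx _))// lerDr.
Unshelve. all: by end_near. Qed.

(** By [dexponent_asymp], minus the derivative of the exponent is [k * v] up to [S * Num.sqrt v],
    where [B = 2 * S / k]. The condition [B <= Num.sqrt v] makes this error at most [k * v / 2], so
    that minus the derivative is at least [k * v / 2]. The factor 2 in [B] thus turns an error
    relative to [k * v] into one relative to the derivative itself. *)
Lemma profile_decay_bounds (R : realType) (k c p q A x : R) :
  let v := ln (ln x) in
  let B := 2 * (`|p| + `|q| + 2 * k * `|c| + 4 * k) / k in
  0 < k -> 0 < A -> 0 < x -> 2 + 2 * `|c| <= v -> B <= Num.sqrt v ->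
  let g := profile_decay k c p q A x in
  let b := B / Num.sqrt v in
  0 <= g /\ (1 - b) * g <= x^-1 * (k * (v / ln x) * profile k c p q A x)
    <= (1 + b) * g.
Proof.
move=> v B k0 A0 x0 hv hs g b.
have c0 : 0 <= `|c| by exact: normr_ge0.
have v0 : 0 < v by lra.
have lx0 := lnln_gt0 _ _ x0 v0.
have s0 : 0 < Num.sqrt v by rewrite sqrtr_gt0.
have sv : v = Num.sqrt v * Num.sqrt v by rewrite -expr2 sqr_sqrtr// ltW.
have := dexponent_asymp _ k c p q v (ltW k0) hv.
set S := _ + 4 * k => hS.
have BE : S = B * k / 2 by rewrite /B -/S; field; rewrite gt_eqF.
set W := profile k c p q A x / (x * ln x).
have W0 : 0 < W.
  by rewrite /W divr_gt0 ?mulr_gt0// /profile ?mulr_gt0 ?expR_gt0.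
have gE : g = W * - dexponent k c p q v.
  by rewrite /g /profile_decay /W -/v; field; rewrite !gt_eqF.
have -> : x^-1 * (k * (v / ln x) * profile k c p q A x) = W * (k * v).
  by rewrite /W; field; rewrite !gt_eqF.
move: hS; rewrite BE ler_norml => /andP[h1 h2].
set d := dexponent k c p q v in gE h1 h2 *.
set s := Num.sqrt v in s0 sv h1 h2 hs b *.
have B0 : 0 <= B.
  have := ltW k0 => k0'.
  by rewrite divr_ge0// mulr_ge0// !addr_ge0// !mulr_ge0.
have kv2 : B * k / 2 * s <= k * v / 2.
  have : B * (k * s) <= s * (k * s) by rewrite ler_wpM2r// mulr_ge0// ltW.
  rewrite {1}sv; lra.
have d0 : k * v / 2 <= - d by lra.
have kv0 : 0 < k * v by rewrite mulr_gt0.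
have bd : B * k / 2 * s <= b * - d.
  have -> : B * k / 2 * s = b * (k * v / 2).
    by rewrite /b sv -/s; field; rewrite gt_eqF.
  by rewrite ler_wpM2l// divr_ge0// ltW.
split; first by rewrite gE mulr_ge0 ?ltW//; lra.
rewrite gE !(mulrCA _ W) !ler_pM2l//.
by apply/andP; split; lra.
Qed.

Lemma ler_lnln (R : realType) (x y : R) :
  0 < x -> 0 < ln (ln x) -> x <= y -> ln (ln x) <= ln (ln y).
Proof.
move=> x0 v0 xy; have lx0 := lnln_gt0 _ _ x0 v0.
have y0 : 0 < y by exact: lt_le_trans xy.
have lxy : ln x <= ln y by rewrite ler_ln.
by rewrite ler_ln// posrE (lt_le_trans lx0).
Qed.

Lemma profile_nonincreasing (R : realType) (k c p q A K x : R) :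
  (forall y, K <= y -> [/\ 0 < y, 0 < ln (ln y) & 0 < c + ln (ln y) / 2]) ->
  (forall y, K <= y -> 0 <= profile_decay k c p q A y) ->
  K <= x -> profile k c p q A x <= profile k c p q A K.
Proof.
move=> hK g0 Kx.
have dG y : K <= y ->
    is_derive y 1 (profile k c p q A) (- profile_decay k c p q A y).
  by move=> /hK[y0 v0 l0]; exact: is_derive_profile.
apply: (@ler0_derive1_nincry _ _ K) => //.
- move=> y; rewrite in_itv/= andbT => /ltW /dG dy; exact: ex_derive.
- move=> y; rewrite in_itv/= andbT => /ltW Ky; have dy := dG _ Ky.
  by rewrite derive1E derive_val oppr_le0 g0.
- apply: derivable_within_continuous => y; rewrite in_itv/= andbT => /dG dy.
  exact: ex_derive.
Qed.

(** With [v = ln (ln x)] the left side is [v / expR v], and [expR v] exceeds [v ^+ 2 / 2]. This weak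
    bound suffices to put the loss caused by the strike within the relative error [v^(-1/2)]. *)
Lemma lnln_div_ln_le (R : realType) (x : R) :
  0 < x -> 1 <= ln (ln x) ->
  ln (ln x) / ln x <= 2 / Num.sqrt (ln (ln x)).
Proof.
move=> x0 v1; have v0 : 0 < ln (ln x) by exact: lt_le_trans v1.
have lx0 := lnln_gt0 _ _ x0 v0.
rewrite -{2}(lnK lx0); move: (ln (ln x)) v1 v0 => v v1 v0.
have s0 : 0 < Num.sqrt v by rewrite sqrtr_gt0.
have s1 : 1 <= Num.sqrt v by rewrite -sqrtr1 ler_wsqrtr.
have sv : Num.sqrt v <= v.
  by rewrite -{2}(sqr_sqrtr (ltW v0)) expr2 ler_peMl// ltW.
rewrite ler_pdivrMr ?expR_gt0// mulrAC ler_pdivlMr//.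
have := expR_ge1Dxn 1%N (ltW v0).
have : v * Num.sqrt v <= v * v by rewrite ler_pM2l.
rewrite (_ : (2`!)%:R = 2)// expr2; lra.
Qed.

(** * Identification of the candidate with the closed formulas *)

Lemma log_sqrt_logE (R : realType) (T y0 x : R) :
  0 < T -> 0 < y0 -> 0 < ln x ->
  log_sqrt_log T y0 x = ln (y0^-1 * Num.sqrt (2 / T)) + ln (ln x) / 2.
Proof.
move=> T0 y0_gt0 lx0.
have T2 : 0 < 2 / T by rewrite divr_gt0.
rewrite /log_sqrt_log mulrAC sqrtrM ?ltW// mulrA lnM ?posrE ?mulr_gt0 ?invr_gt0 ?sqrtr_gt0//.
congr (_ + _).
by rewrite -powR12_sqrt ?ltW// ln_powR mulrC.
Qed.

(** The value of [k] makes [2 * k] the coefficient [1 / (2 * T * xi ^+ 2)] in [hw_exp], and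
    [log_sqrt_logE] identifies [c]. *)
Lemma profileE (R : realType) (T xi y0 C0 c2 c3 x : R) :
  0 < T -> 0 < xi -> 0 < y0 -> 0 < x -> 0 < ln (ln x) ->
  profile (4 * T * xi ^+ 2)^-1 (ln (y0^-1 * Num.sqrt (2 / T)))
    ((c2 + 1) / 2) (c3 - 1) (4 * T * xi ^+ 2 * C0) x =
  4 * T * xi ^+ 2 * C0 * ln x `^ ((c2 + 1) / 2) * ln (ln x) `^ (c3 - 1)
    * hw_exp T xi y0 x.
Proof.
move=> T0 xi0 y0_gt0 x0 v0; have lx0 := lnln_gt0 _ _ x0 v0.
rewrite /profile /exponent !expRD -!mulrA; congr (_ * (_ * (_ * (_ * _)))).
rewrite /powR !gt_eqF// !mulrA; congr (_ * _ * _).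
rewrite /hw_exp log_sqrt_logE//; congr expR.
by field; rewrite !gt_eqF.
Qed.

(** Relative to the price, the density has one power of log x less and one power of log log x more,
    which gives the factor [ln (ln x) / ln x]; [k] cancels the constant [4 * T * xi ^+ 2]. *)
Lemma densityE (R : realType) (T xi y0 C0 c2 c3 x : R) :
  0 < T -> 0 < xi -> 0 < y0 -> 0 < x -> 0 < ln (ln x) ->
  C0 * x ^- 2 * ln x `^ ((c2 - 1) / 2) * ln (ln x) `^ c3 * hw_exp T xi y0 x =
  x ^- 2 * ((4 * T * xi ^+ 2)^-1 * (ln (ln x) / ln x) *
    profile (4 * T * xi ^+ 2)^-1 (ln (y0^-1 * Num.sqrt (2 / T)))
      ((c2 + 1) / 2) (c3 - 1) (4 * T * xi ^+ 2 * C0) x).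
Proof.
move=> T0 xi0 y0_gt0 x0 v0; have lx0 := lnln_gt0 _ _ x0 v0.
have powRS (a s : R) : 0 < a -> a `^ (s + 1) = a * a `^ s.
  move=> a0; rewrite powRD; last by rewrite (gt_eqF a0) implybT.
  by rewrite powRr1 ?ltW// mulrC.
rewrite profileE// -[in LHS](subrK 1 c3) (_ : (c2 + 1) / 2 = (c2 - 1) / 2 + 1); last by field.
rewrite !powRS//.
by field; rewrite !gt_eqF.
Qed.

(** * Transfer of the estimates to the Hull-White call price *)

Lemma measurable_of_adapted (R : realType) d (Omega : measurableType d)
    (F : R -> set (set Omega)) (X : R -> Omega -> R) (t : R) :
  is_filtration F -> adapted F X -> 0 <= t -> measurable_fun setT (X t).
Proof.
move=> [_ FM _] aX t0 _ B mB; rewrite setTI.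
exact: (FM t t0 _ (aX t t0 B mB)).
Qed.

Lemma equiv_uptoP (R : realType) (f : R -> \bar R) (g h : R -> R) :
  equiv_upto f g h <->
  exists2 e : R -> R, (exists2 k, 0 < k &
    \forall x \near +oo, `|e x| <= k * `|h x|) &
    \forall x \near +oo, f x = (g x * (1 + e x))%:E.
Proof.
split=> [[e [/eqO_exP[k k0 ke] fe]]|[e [k k0 ke] fe]].
  by exists e => //; exists k.
by exists e; split => //; apply/eqO_exP; exists k.
Qed.

Lemma near_pinfty_forall_ge (R : realType) (Q : R -> Prop) :
  (\forall x \near +oo, Q x) -> \forall K \near +oo, forall x, K <= x -> Q x.
Proof.
move=> [M [Mr HM]]; exists M; split => // K MK x Kx.
by apply: HM; exact: lt_le_trans Kx.
Qed.

Theorem theorem7p5 (R : realType) (d : measure_display)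
    (Omega : measurableType d) (P : probability Omega R)
    (F : R -> set (set Omega)) (W Z X Y : R -> Omega -> R)
    (r nu xi x0 y0 T C0 c2 c3 : R) (D : R -> R)
    (hr : 0 <= r) (hxi : 0 < xi) (hx0 : 0 < x0) (hy0 : 0 < y0) (hT : 0 < T)
    (hHW : hull_white r nu xi x0 y0 F P W Z X Y)
    (hD : is_density P (X T) D)
    (hC0 : 0 < C0)
    (hDas : equiv_upto (fun x => (D x)%:E)
      (fun x => C0 * x ^- 2 * ln x `^ ((c2 - 1) / 2) * ln (ln x) `^ c3
                * hw_exp T xi y0 x)
      (fun x => ln (ln x) `^ (- (1 / 2)))) :
  equiv_upto (call_price P X r T)
    (fun K => 4 * T * xi ^+ 2 * C0 * expR (- (r * T))
              * ln K `^ ((c2 + 1) / 2) * ln (ln K) `^ (c3 - 1)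
              * hw_exp T xi y0 K)
    (fun K => ln (ln K) `^ (- (1 / 2))).
Proof.
have mX : measurable_fun setT (X T).
  have [hF _ _ [aX _ _ _] _] := hHW.
  exact: measurable_of_adapted hF aX (ltW hT).
have [mD D0 _] := hD.
have [e [L L0 eL] De] := (equiv_uptoP _ _ _ _).1 hDas.
set k := (4 * T * xi ^+ 2)^-1.
set c := ln (y0^-1 * Num.sqrt (2 / T)).
set p := (c2 + 1) / 2; set q := c3 - 1.
set A := 4 * T * xi ^+ 2 * C0.
have TX0 : 0 < 4 * T * xi ^+ 2 by rewrite !mulr_gt0// exprn_gt0.
have k0 : 0 < k by rewrite invr_gt0.
have A0 : 0 < A by rewrite mulr_gt0.
pose B := 2 * (`|p| + `|q| + 2 * k * `|c| + 4 * k) / k.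
have B0 : 0 <= B.
  have := ltW k0 => k0'.
  by rewrite /B divr_ge0// mulr_ge0// !addr_ge0// !mulr_ge0.
(* [N] dominates [L], [B] and 1, so that [N * del K <= 1] controls all three error terms at once.
   [V] combines the threshold of [profile_decay_bounds] with [N ^+ 2], which yields
   [N <= Num.sqrt (ln (ln x))]. *)
pose N := L + B + 1.
pose V := 2 + 2 * `|c| + N ^+ 2.
have c0 : 0 <= `|c| by exact: normr_ge0.
have [cl cu] : - `|c| <= c /\ c <= `|c|.
  by apply/andP; rewrite -ler_norml.
pose G := profile k c p q A.
pose del (x : R) := (Num.sqrt (ln (ln x)))^-1.
have N0 : 0 <= N by rewrite !addr_ge0// ltW.
have N2 : 0 <= N ^+ 2 by exact: exprn_ge0.
have delE x : 0 < ln (ln x) -> ln (ln x) `^ (- (1 / 2)) = del x.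
  by move=> v0; rewrite powRN div1r powR12_sqrt// ltW.
(* [L + B + L * B] comes from multiplying the two relative errors, and [2 * k] from the strike term
   [2 * k * del K * G K]. *)
pose M1 := L + B + L * B + 2 * k.
have M10 : 0 < M1.
  have L0' := ltW L0.
  have LB0 : 0 <= L * B by rewrite mulr_ge0.
  by rewrite /M1; lra.
have main : \forall K \near +oo, [/\ 0 < K, 0 < ln (ln K) & exists I : R,
    call_price P X r T K = (expR (- (r * T)) * I)%:E /\
    `|I - G K| <= M1 * del K * G K].
  near=> K.
  have hK : forall x, K <= x -> 1 < x /\ V <= ln (ln x).
    by near: K; apply: near_pinfty_forall_ge; exact: near_lnln.
  have hDe : forall x, K <= x -> (D x)%:E = (C0 * x ^- 2 * ln x `^ ((c2 - 1) / 2) *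
      ln (ln x) `^ c3 * hw_exp T xi y0 x * (1 + e x))%:E.
    by near: K; apply: near_pinfty_forall_ge; exact: De.
  have heL : forall x, K <= x -> `|e x| <= L * `|ln (ln x) `^ (- (1 / 2))|.
    by near: K; apply: near_pinfty_forall_ge; exact: eL.
  have pos x : K <= x -> [/\ 0 < x, 0 < ln (ln x) & 0 < c + ln (ln x) / 2].
    move=> /hK[x1]; rewrite /V => hv; split; [exact: lt_trans x1|lra|lra].
  have [K0 v0 l0] := pos K (lexx K).
  have sV x : K <= x -> N <= Num.sqrt (ln (ln x)).
    move=> Kx; have [_ hv] := hK _ Kx; rewrite -[N]ger0_norm// -sqrtr_sqr.
    by rewrite ler_wsqrtr// (le_trans _ hv)// /V lerDr; lra.
  have del0 x : K <= x -> 0 < del x.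
    by move=> /pos[_ vx _]; rewrite invr_gt0 sqrtr_gt0.
  (* [call_integral_bounds] needs error constants valid on the whole half-line; as [del] decreases,
     its value at [K] serves. *)
  have delK x : K <= x -> del x <= del K.
    move=> Kx; have [x0' vx _] := pos _ Kx.
    by rewrite lef_pV2 ?posrE ?sqrtr_gt0// ler_wsqrtr// ler_lnln.
  have delN : N * del K <= 1.
    by rewrite ler_pdivrMr ?sqrtr_gt0// mul1r sV.
  have dK0 := del0 _ (lexx K).
  have dN1 a : 0 <= a -> a <= N -> 0 <= a * del K <= 1.
    move=> a0 aN; apply/andP; split; first by rewrite mulr_ge0// ltW.
    by rewrite (le_trans _ delN)// ler_wpM2r// ltW.
  have Ld1 : 0 <= L * del K <= 1 by apply: dN1; rewrite /N; lra.
  have Bd1 : 0 <= B * del K <= 1 by apply: dN1; rewrite /N; lra.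
  have /andP[_ d1] : 0 <= 1 * del K <= 1 by apply: dN1; rewrite /N; lra.
  have bounds x (Kx : K <= x) :=
    let: And3 x0' _ _ := pos _ Kx in
    profile_decay_bounds _ k c p q A x k0 A0 x0'.
  have bds x : K <= x -> 0 <= profile_decay k c p q A x /\
    (1 - B * del x) * profile_decay k c p q A x <=
      x^-1 * (k * (ln (ln x) / ln x) * G x) <=
    (1 + B * del x) * profile_decay k c p q A x.
    move=> Kx; apply: bounds => //.
    - by have [_] := hK _ Kx; rewrite /V; lra.
    - by apply: le_trans (sV _ Kx); rewrite /N -/B; lra.
  have G0 x : 0 < G x by rewrite mulr_gt0// expR_gt0.
  have GK x : K <= x -> G x <= G K.
    by apply: profile_nonincreasing => // y /bds[].
  have h0 x : K <= x -> 0 <= k * (ln (ln x) / ln x) * G x.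
    move=> /pos[x0' vx _]; have lx0 := lnln_gt0 _ _ x0' vx.
    by rewrite !mulr_ge0 ?invr_ge0// ltW.
  have hDh x : K <= x ->
      (1 - L * del K) * (x ^- 2 * (k * (ln (ln x) / ln x) * G x)) <= D x <=
      (1 + L * del K) * (x ^- 2 * (k * (ln (ln x) / ln x) * G x)).
    move=> Kx; have [x0' vx _] := pos _ Kx.
    have [Dx] := hDe _ Kx; rewrite densityE// -/k -/c -/p -/q -/A -/(G x) in Dx.
    have := heL _ Kx; rewrite delE// (gtr0_norm (del0 _ Kx)) => ex.
    have eK : `|e x| <= L * del K.
      by rewrite (le_trans ex)// ler_wpM2l ?delK// ltW.
    have Q0 : 0 <= x ^- 2 * (k * (ln (ln x) / ln x) * G x).
      by rewrite mulr_ge0 ?h0// invr_ge0 exprn_ge0// ltW.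
    rewrite Dx mulrC (mulrC _ (1 + e x)); move: eK; rewrite ler_norml => /andP[e1 e2].
    by rewrite mulrC !ler_wpM2r//; lra.
  have hhg x : K <= x -> (1 - B * del K) * profile_decay k c p q A x <=
      x^-1 * (k * (ln (ln x) / ln x) * G x) <=
      (1 + B * del K) * profile_decay k c p q A x.
    move=> Kx; have [g0 /andP[g1 g2]] := bds _ Kx.
    have BK : B * del x <= B * del K by rewrite ler_wpM2l// delK.
    rewrite (le_trans _ g1) ?(le_trans g2)// ler_wpM2r//; lra.
  (* The bound [M] on [h]: [G] is largest at [K], and [ln (ln x) / ln x] is at most [2 * del K]. *)
  have hhM x : K <= x -> k * (ln (ln x) / ln x) * G x <= 2 * k * del K * G K.
    move=> Kx; have [x0' vx _] := pos _ Kx; have lx0 := lnln_gt0 _ _ x0' vx.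
    have dx : ln (ln x) / ln x <= 2 * del K.
      rewrite (le_trans (lnln_div_ln_le _ _ x0' _)) ?ler_wpM2l ?delK//.
      by have [_] := hK _ Kx; rewrite /V; lra.
    rewrite (_ : 2 * k * del K = k * (2 * del K)); last by ring.
    rewrite ler_pM ?GK ?ler_wpM2l//; first last.
    - exact: ltW.
    - exact: ltW.
    - by rewrite mulr_ge0 ?divr_ge0// ltW.
  have [I [IE /andP[Il Iu]]] := call_integral_bounds _ D G (profile_decay k c p q A)
    (fun x => k * (ln (ln x) / ln x) * G x) K (L * del K) (B * del K)
    (2 * k * del K * G K) K0 Ld1 Bd1 mD D0
    (fun x Kx => let: And3 x0' v0' l0' := pos x Kx in
       is_derive_profile _ _ _ _ _ _ _ x0' v0' l0')
    (fun x Kx => let: And3 x0' v0' l0' := pos x Kx in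
       continuous_profile_decay _ _ _ _ _ _ _ x0' v0' l0')
    (fun x Kx => (bds x Kx).1)
    (cvg_profile _ _ _ _ _ _ k0 (ltW A0)) hDh hhg hhM.
  split => //; exists I; split.
    by rewrite (call_price_density _ _ _ _ _ _ _ _ _ mX hD) IE EFinM.
  have GK0 := G0 K; rewrite -/(G K) in Il Iu.
  (* Since [del K <= 1], the product of the two errors is again of order [del K]. *)
  have LB : L * del K * (B * del K) <= L * B * del K.
    rewrite mulrACA; apply: ler_wpM2l; first by rewrite mulr_ge0// ltW.
    by apply: ler_piMr; [exact: ltW|lra].
  have LBG : L * del K * (B * del K) * G K <= L * B * del K * G K.
    by rewrite ler_wpM2r// ltW.
  have [/andP[La _] /andP[Lb _]] := (Ld1, Bd1).
  have [GK0' dK0'] := (ltW GK0, ltW dK0).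
  have LBG0 : 0 <= L * del K * (B * del K) * G K.
    by apply: mulr_ge0 => //; exact: mulr_ge0.
  have kdG : 0 <= k * del K * G K by rewrite !mulr_ge0// ltW.
  by rewrite ler_norml /M1; apply/andP; split; lra.
(* The relative error is dictated by the equation to prove; [fine] loses nothing for large [K],
   where [main] shows the price to be finite. *)
pose E K := fine (call_price P X r T K) / (expR (- (r * T)) * G K) - 1.
apply/equiv_uptoP; exists E.
  exists M1 => //; near=> K.
  have [K0 v0 [I [IE hI]]] : [/\ 0 < K, 0 < ln (ln K) & exists I : R,
    call_price P X r T K = (expR (- (r * T)) * I)%:E /\
    `|I - G K| <= M1 * del K * G K] by near: K.
  have GK0 : 0 < G K by rewrite mulr_gt0// expR_gt0.
  have d0 : 0 < del K by rewrite invr_gt0 sqrtr_gt0.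
  rewrite delE// (gtr0_norm d0) /E IE/=.
  have -> : expR (- (r * T)) * I / (expR (- (r * T)) * G K) - 1 = (I - G K) / G K.
    by field; rewrite !gt_eqF// expR_gt0.
  by rewrite normrM normfV (gtr0_norm GK0) ler_pdivrMr.
near=> K.
have [K0 v0 [I [IE hI]]] : [/\ 0 < K, 0 < ln (ln K) & exists I : R,
  call_price P X r T K = (expR (- (r * T)) * I)%:E /\
  `|I - G K| <= M1 * del K * G K] by near: K.
have GK0 : 0 < G K by rewrite mulr_gt0// expR_gt0.
have GE := profileE _ T xi y0 C0 c2 c3 K hT hxi hy0 K0 v0.
rewrite -/k -/c -/p -/q -/A -/(G K) in GE *.
rewrite /E IE/=; congr EFin.
rewrite (_ : A * expR (- (r * T)) * ln K `^ p * ln (ln K) `^ q * hw_exp T xi y0 K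
  = expR (- (r * T)) * G K); last by rewrite GE; ring.
by field; rewrite !gt_eqF// expR_gt0.
Unshelve. all: by end_near. Qed.
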